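(* Let $-1<D<C\le 1$ and let $\alpha_1,\alpha_2>0$ satisfy $$(\alpha_1-\alpha_2)(1-D^2)\ \ge\ e\,(C-D)(1+|D|).$$ Let $p$ be analytic in $\mathbb{D}$ with $p(0)=1$. If $$1+\alpha_1 z p'(z)+\alpha_2 z^2 p''(z)\prec \frac{1+Cz}{1+Dz}\qquad (z\in\mathbb{D}),$$ then $p(z)\prec e^z$.
   Context: $\mathbb{D}=\{z\in\mathbb{C}:|z|<1\}$. For functions $g,h$ analytic in $\mathbb{D}$, $g\prec h$ ($g$ is subordinate to $h$) means there is an analytic $w:\mathbb{D}\to\mathbb{D}$ with $w(0)=0$ and $g=h\circ w$; when $h$ is univalent this is equivalent to $g(0)=h(0)$ and $g(\mathbb{D})\subseteq h(\mathbb{D})$. *)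

(* Defs.v *)
From HB Require Import structures.
From mathcomp Require Import all_boot all_order all_algebra.
From mathcomp Require Import all_classical all_reals all_analysis.
From mathcomp Require Import complex.
Set Implicit Arguments. Unset Strict Implicit. Unset Printing Implicit Defensive.
Import Order.TTheory GRing.Theory Num.Theory ComplexField.
Import numFieldNormedType.Exports.
Local Open Scope ring_scope.
Local Open Scope complex_scope.

Definition analytic_in_disc (R : realType) (f : R[i]^o -> R[i]^o) : Prop :=
  forall z : R[i]^o, `|z| < 1 -> derivable f z 1.

Definition subordinate (R : realType) (g h : R[i]^o -> R[i]^o) : Prop :=
  exists w : R[i]^o -> R[i]^o,
    [/\ analytic_in_disc w, w 0 = 0,
        (forall z : R[i]^o, `|z| < 1 -> `|w z| < 1) &
        (forall z : R[i]^o, `|z| < 1 -> g z = h (w z))].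

Definition expC (R : realType) (z : R[i]^o) : R[i]^o :=
  let: a +i* b := z in (expR a)%:C * ((cos b) +i* (sin b)).

(* Main.v *)
(* Put q(z) = z p'(z), F(z) = a1 z p'(z) + a2 z^2 p''(z) and r = 1/e. The
   hypothesis gives |F| <= (C - D) / (1 - |D|) <= (a1 - a2) r. Since
   a2 z q' + (a1 - a2) q = F, along a ray from the origin Re(c q) (|c| = 1) cannot
   increase while it exceeds r, and therefore |q| <= r on the disc. Hence p moves
   by at most r |u - v| between the points of arguments u and v of a circle about
   the origin; as the mean of p over the circle is p(0) = 1, this gives
   |p - 1| <= r pi / 2 < 1 - 1/e. Finally |log(1 + x)| <= - log(1 - |x|), so log p
   takes its values in the unit disc.

   Only the complex differentiability of p is available: neither the continuity of
   p' nor the existence of p'' is used. The ray argument gets along with the mean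
   value theorem, and the mean value property follows by differentiating under
   the Lebesgue integral, the bound on q providing the domination. *)
Require Import Defs.
From HB Require Import structures.
From mathcomp Require Import all_boot all_order all_algebra.
From mathcomp Require Import all_classical all_reals all_analysis.
From mathcomp Require Import complex.
From mathcomp Require Import ring lra.
Import Order.TTheory GRing.Theory Num.Theory ComplexField.
Import numFieldNormedType.Exports.
Local Open Scope ring_scope.
Local Open Scope complex_scope.
Import Normc.

(** * Complex derivatives as linear approximation *)

(** Multiplied out by [h], the estimate on the difference quotient also covers [h = 0], and
    punctured neighbourhoods disappear. *)
Lemma is_derive1P {K : numFieldType} (f : K^o -> K^o) (z l : K^o) :
  is_derive z 1 f l <->
  forall eps : K, 0 < eps ->
    \forall h \near (0 : K^o), `|f (h + z) - f z - l * h| <= eps * `|h|.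
Proof.
have E h : h != 0 -> `|l - h^-1 *: (f (h *: 1 + z) - f z)| =
    `|f (h + z) - f z - l * h| / `|h|.
  move=> h0; rewrite -normfV -normrM distrC.
  have -> : h *: (1 : K^o) = h by rewrite /GRing.scale /= mulr1.
  rewrite /GRing.scale /=; congr (`| _ |); field; exact: h0.
split=> [[df vf] eps e0|H].
  have := df; rewrite /derivable => /cvg_ex [l' Hl'].
  have ll : l' = l by rewrite -vf; apply/esym/cvg_lim.
  move: Hl'; rewrite ll => /cvgrPdist_le/(_ eps e0).
  rewrite /dnbhs near_withinE; apply: filterS => h Hh.
  have [->|h0] := eqVneq h 0.
    by rewrite add0r subrr sub0r mulr0 oppr0 normr0 mulr0.
  by move: (Hh h0); rewrite /= E// ler_pdivrMr// normr_gt0.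
have C : (h^-1 *: (f (h *: 1 + z) - f z) @[h --> 0^'] --> l)%classic.
  apply/cvgrPdist_le => eps e0.
  rewrite /dnbhs near_withinE; apply: filterS (H _ e0) => h Hh h0.
  by rewrite /= E// ler_pdivrMr// normr_gt0.
by split; [apply/cvg_ex; exists l | apply/cvg_lim].
Qed.

Section Complex_derivatives.
Context {R : realType}.
Implicit Types (x z l c : R[i]) (f : R[i]^o -> R[i]^o) (t : R).

Lemma normc_ge0 x : 0 <= normc x.
Proof. by case: x => a b; rewrite /normc sqrtr_ge0. Qed.

Lemma normc_real t : normc t%:C = `|t|.
Proof. by rewrite /normc /= expr0n /= addr0 sqrtr_sqr. Qed.

Lemma normr_Re x : `|complex.Re x| <= normc x.
Proof.
case: x => a b /=; rewrite -sqrtr_sqr ler_wsqrtr// lerDl; exact: sqr_ge0.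
Qed.

Lemma normr_Im x : `|complex.Im x| <= normc x.
Proof.
case: x => a b /=; rewrite -sqrtr_sqr ler_wsqrtr// lerDr; exact: sqr_ge0.
Qed.

Lemma normc_le_ReIm x : normc x <= `|complex.Re x| + `|complex.Im x|.
Proof.
case: x => a b /=; rewrite -(ger0_norm (addr_ge0 (normr_ge0 a) (normr_ge0 b))).
rewrite -sqrtr_sqr ler_wsqrtr// sqrrD !real_normK ?num_real//.
rewrite addrAC lerDl mulrn_wge0// mulr_ge0//.
Qed.

Lemma normc_lt1 (z : R[i]^o) : (`|z| < 1) = (normc z < 1).
Proof. by rewrite -ltcR. Qed.

(** The norm of [R[i]] takes its values in [R[i]]; here tolerance and radius become real numbers,
    and the norm becomes [normc]. *)
Lemma is_derive_normcP f z l :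
  is_derive (z : R[i]^o) 1 f l <->
  forall eps : R, 0 < eps -> exists2 d : R, 0 < d &
    forall h, normc h < d -> normc (f (h + z) - f z - l * h) <= eps * normc h.
Proof.
rewrite is_derive1P; split=> H eps e0.
  have /H : 0 < eps%:C by rewrite ltcR.
  move=> /nbhs_normP [d d0 Hd].
  have dR : (complex.Re d)%:C = d by rewrite RRe_real// ger0_real// ltW.
  exists (complex.Re d) => [|h hd]; first by rewrite -ltcR dR.
  have /= := Hd h; rewrite /= sub0r normrN -dR ltcR => /(_ hd).
  by rewrite -lecR rmorphM.
have eR : (complex.Re eps)%:C = eps by rewrite RRe_real// ger0_real// ltW.
have /H[d d0 Hd] : 0 < complex.Re eps by rewrite -ltcR eR.
apply/nbhs_normP; exists d%:C => [|h]; first by rewrite /= ltcR.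
rewrite /= sub0r normrN ltcR => /Hd; rewrite -lecR rmorphM/= eR.
exact.
Qed.

Lemma Re_mulB c x y l t : complex.Re (c * (x - y - l * t%:C)) =
  complex.Re (c * x) - complex.Re (c * y) - complex.Re (c * l) * t.
Proof. by case: c x y l => [? ?] [? ?] [? ?] [? ?] /=; ring. Qed.

(** Multiplying by [c] and taking the real part is real-linear and enlarges [normc] by at most the
    factor [normc c]. This brings complex functions within reach of the real mean value theorem. *)
Lemma is_derive_Re f t l c : is_derive (t%:C : R[i]^o) 1 f l ->
  is_derive t 1 (fun s : R => complex.Re (c * f s%:C)) (complex.Re (c * l)).
Proof.
move=> /is_derive_normcP H; apply/(@is_derive1P R) => eps e0.
have c0 : 0 < normc c + 1 by rewrite ltr_pwDr// normc_ge0.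
have /H[d d0 Hd] : 0 < eps / (normc c + 1) by rewrite divr_gt0.
apply/nbhs_normP; exists d => //= h; rewrite /= sub0r normrN => hd.
have := Hd h%:C; rewrite normc_real => /(_ hd).
have -> : complex.Re (c * f (h + t)%:C) - complex.Re (c * f t%:C)
    - complex.Re (c * l) * h = complex.Re (c * (f (h%:C + t%:C) - f t%:C - l * h%:C)).
  by rewrite -rmorphD Re_mulB.
move=> Hh; apply: le_trans (normr_Re _) _; rewrite normcM.
apply: le_trans (ler_wpM2l (normc_ge0 _) Hh) _.
rewrite !mulrA ler_wpM2r// ler_pdivrMr// mulrDr mulr1 mulrC lerDl; exact: ltW.
Qed.

End Complex_derivatives.

(** * The chain rule, and a growth bound along a ray *)

Lemma is_derive_comp {K : numFieldType} (f g : K^o -> K^o) (x a b : K^o) :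
  is_derive (g x) 1 f a -> is_derive x 1 g b -> is_derive x 1 (f \o g) (a * b).
Proof.
move=> [df vf] [dg vg].
have Df : differentiable f (g x) by apply/derivable1_diffP.
have Dg : differentiable g x by apply/derivable1_diffP.
split; first by apply/derivable1_diffP/differentiable_comp.
rewrite deriveE; last exact: differentiable_comp.
rewrite diff_comp//= -vf -vg !deriveE//.
by rewrite -[X in 'd _ _ X = _]mulr1 [LHS]linearZ mulrC.
Qed.

Lemma is_derive_affine {K : numFieldType} (a b z : K^o) :
  is_derive z 1 (fun x : K^o => a + x * b) b.
Proof.
apply/is_derive1P => e e0; apply/nbhs_normP; exists 1 => //= h _.
have -> : a + (h + z) * b - (a + z * b) - b * h = 0 by ring.
by rewrite normr0 mulr_ge0 ?(ltW e0).
Qed.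

Lemma is_derive_add {R : realType} (f g : R -> R) (t a b : R) :
  is_derive t 1 f a -> is_derive t 1 g b ->
  is_derive t 1 (fun s => f s + g s) (a + b).
Proof. exact: is_deriveD. Qed.

(* On each interval to the left of [1] where [v > r], [v] is nonincreasing, hence
   [v >= v 1 > r] there. At the left end [a] of the maximal such interval,
   [v a = a * f' a] inherits the bound because derivatives satisfy the mean value
   theorem, even though [v] need not be continuous at [a]; so [a = 0], and then
   [f' t >= v 1 / t] contradicts the continuity of [f] at [0]. *)
Lemma ray_bound {R : realType} (f v : R -> R) (r : R) : 0 <= r ->
  (forall t : R, 0 < t -> t <= 1 -> is_derive t 1 f (v t / t)) ->
  {for 0, continuous f} ->
  (forall t : R, 0 < t -> t <= 1 -> r < v t -> exists2 l, is_derive t 1 v l & l <= 0) ->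
  v 1 <= r.
Proof.
move=> r0 df f0 dv; rewrite leNgt; apply/negP => rV.
pose V := v 1; have V0 : 0 < V by exact: le_lt_trans rV.
pose A := [set t : R | 0 < t /\ forall s, t <= s -> s <= 1 -> r < v s]%classic.
have A1 : A 1.
  by split=> // s s1 s1'; have -> : s = 1 by apply/le_anti; rewrite s1 s1'.
have lA : lbound A 0 by move=> t [/ltW].
pose a := inf A.
have hA : has_inf A by split; [exists 1|exists 0].
have a0 : 0 <= a by apply: lb_le_inf => //; exists 1.
have a1 : a <= 1 by apply: ge_inf => //; exists 0.
have H1 s : a < s -> s <= 1 -> r < v s.
  move=> as_ s1; have := @inf_adherent _ A (s - a).
  rewrite subr_gt0 => /(_ as_ hA) [t [_ tA]]; rewrite subrKC => ts.
  by apply: tA => //; exact: ltW.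
have H2 s : a < s -> s <= 1 -> V <= v s.
  move=> as_ s1; have dvs x : x \in `[s, 1] -> exists2 l, is_derive x 1 v l & l <= 0.
    rewrite in_itv /= => /andP[sx x1].
    have ax : a < x by exact: lt_le_trans sx.
    by apply: dv => //; [exact: le_lt_trans ax | exact: H1].
  have sub x : x \in `]s, 1[ -> x \in `[s, 1].
    by rewrite !in_itv /= => /andP[/ltW -> /ltW ->].
  apply: (@ler0_derive1_le_cc _ v s 1) => //.
  - by move=> x /sub /dvs [l [? _] _].
  - by move=> x /sub /dvs [l dl l0]; rewrite derive1E (@derive_val _ _ _ _ _ _ _ dl).
  - by apply: derivable_within_continuous => x /dvs [l [? _] _].
  - by rewrite in_itv /= lexx s1.
  - by rewrite in_itv /= lexx s1.
(* Mean value theorem: on []s, t[] the derivative [v x / x] of [f] is at least [V / t]. *)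
have D s t : 0 < s -> a <= s -> s < t -> t <= 1 -> V / t * (t - s) <= f t - f s.
  move=> s0 as_ st t1.
  have [||x] := @MVT R f (fun x => v x / x) s t st.
  - move=> x; rewrite in_itv /= => /andP[sx xt]; apply: df.
      exact: lt_trans sx.
    by rewrite ltW// (lt_le_trans xt).
  - apply: derivable_within_continuous => x; rewrite in_itv /= => /andP[sx xt].
    by apply: ex_derive; apply: df; [exact: lt_le_trans sx|exact: le_trans t1].
  rewrite in_itv /= => /andP[sx xt] ->; rewrite ler_wpM2r ?subr_ge0 ?(ltW st)//.
  have x0 : 0 < x by exact: lt_trans sx.
  have t0 : 0 < t by exact: lt_trans xt.
  rewrite ler_pM ?(ltW V0) ?invr_ge0 ?(ltW t0)//.
    by apply: H2; [exact: le_lt_trans sx|rewrite ltW// (lt_le_trans xt)].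
  by rewrite lef_pV2 ?posrE// ltW.
move: a0; rewrite le_eqVlt => /predU1P[a0|a0].
  (* If [a = 0], then [f] grows by at least [V / 2] from [t / 2] to [t], although near [0] it stays
     within less than [V / 4] of [f 0]. *)
  have /cvgrPdist_lt/(_ (V / 4)) := f0; rewrite divr_gt0// => /(_ isT).
  move=> /nbhs_normP [d /= d0 Hd].
  pose t := Num.min 1 (d / 2).
  have t0 : 0 < t by rewrite lt_min ltr01 divr_gt0.
  have td : t < d.
    by rewrite /t gt_min; apply/orP; right; rewrite ltr_pdivrMr// mulr2n mulrDr mulr1 ltrDl.
  have t1 : t <= 1 by rewrite /t ge_min lexx.
  have /= b1 : `|f 0 - f t| < V / 4 by apply: Hd; rewrite /= sub0r normrN gtr0_norm.
  have /= b2 : `|f 0 - f (t / 2)| < V / 4.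
    apply: Hd; rewrite /= sub0r normrN gtr0_norm ?divr_gt0//.
    by apply: lt_trans td; rewrite ltr_pdivrMr// mulr2n mulrDr mulr1 ltrDl.
  have := D (t / 2) t; rewrite -a0 divr_ge0 ?(ltW t0)// divr_gt0// => /(_ isT isT).
  rewrite ltr_pdivrMr// mulr2n mulrDr mulr1 ltrDl => /(_ t0 t1).
  have -> : V / t * (t - t / (1 + 1)) = V / 2 by field; rewrite gt_eqF.
  move: b1 b2; rewrite !ltr_norml => /andP[? ?] /andP[? ?]; lra.
have ra : r < v a.
  move: a1; rewrite le_eqVlt => /predU1P[->//|a1].
  rewrite ltNge; apply/negP => var.
  have vV : v a < V by exact: le_lt_trans rV.
  have := df _ a0 (ltW a1); rewrite is_derive1P => /(_ ((V - v a) / (2 * a))).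
  rewrite divr_gt0 ?subr_gt0// ?mulr_gt0// => /(_ isT) /nbhs_normP [d /= d0 Hd].
  (* Comparing the slope [v a / a] of [f] at [a] with [D] gives [V <= (V + v a) / 2 * (1 + h / a)];
     the last bound on [h] makes the right-hand side smaller than [V]. *)
  pose h := Num.min (d / 2) (Num.min (1 - a) (a * (V - v a) / (2 * V))).
  have h0 : 0 < h.
    by rewrite !lt_min divr_gt0//= subr_gt0 a1/= divr_gt0 ?mulr_gt0 ?subr_gt0.
  have hd : h < d.
    by rewrite /h gt_min; apply/orP; left; rewrite ltr_pdivrMr// mulr2n mulrDr mulr1 ltrDl.
  have h1 : h <= 1 - a by rewrite /h !ge_min lexx orbT.
  have h2 : h <= a * (V - v a) / (2 * V) by rewrite /h !ge_min lexx !orbT.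
  have := Hd h; rewrite /= sub0r normrN gtr0_norm// => /(_ hd).
  rewrite ler_norml => /andP[_ U].
  have := D a (h + a) a0 (lexx _); rewrite ltrDr addrK => /(_ h0).
  have -> : h + a <= 1 by lra.
  move=> /(_ isT) L.
  have {L U} : V / (h + a) * h <= (v a / a + (V - v a) / (2 * a)) * h by lra.
  rewrite ler_pM2r// ler_pdivrMr ?addr_gt0//.
  have -> : (v a / a + (V - v a) / (2 * a)) * (h + a) =
     (V + v a) / 2 * (1 + h / a) by field; rewrite gt_eqF.
  move=> L.
  have {}h2 : h / a <= (V - v a) / (2 * V).
    by rewrite ler_pdivrMr// mulrC mulrA.
  have h3 : (h / a) * (2 * V) <= V - v a by rewrite -ler_pdivlMr// mulr_gt0.
  have ha : 0 < h / a by rewrite divr_gt0.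
  move: ha h3 L; move: (h / a) => k k0 h3 L; nra.
have [l [dva _] _] := dv _ a0 a1 ra.
have /cvgrPdist_lt/(_ (v a - r)) : {for a, continuous v}.
  exact/differentiable_continuous/derivable1_diffP.
rewrite subr_gt0 => /(_ ra) /nbhs_normP [d /= d0 Hd].
(* Continuity of [v] at [a] keeps [v] above [r] on [[b, a]], so that [b < a] lies in [A], against
   [a = inf A]. *)
pose b := Num.max (a - d / 2) (a / 2).
have b0 : 0 < b by rewrite lt_max [X in _ || X]divr_gt0 ?orbT.
have ba : b < a by rewrite gt_max; apply/andP; split; lra.
suff : a <= b by rewrite leNgt ba.
apply: ge_inf; first by exists 0.
split=> // s bs s1; have [sa|as_] := leP s a; last exact: H1.
have : `|v a - v s| < v a - r.
  apply: Hd; rewrite /= ger0_norm ?subr_ge0//.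
  have : a - d / 2 <= b by rewrite /b le_max lexx.
  lra.
rewrite ltr_norml => /andP[_]; lra.
Qed.

(** * Integrals over a period and means over circles *)

Lemma Rintegral_shift {R : realType} (g : R -> R) (a b h : R) :
  a <= b -> continuous g ->
  \int[lebesgue_measure]_(x in `[a, b]) g (x + h) =
  \int[lebesgue_measure]_(x in `[a + h, b + h]) g x.
Proof.
move=> ab cg.
have dF : ((fun x : R => x + h)^`() = cst 1)%classic.
  by apply/funext => x; rewrite derive1E derive_val addr0.
have cF : continuous (fun x : R => x + h) by move=> x; apply: cvgD => //; exact: cvg_cst.
rewrite /Rintegral (@integration_by_substitution_increasing _ (fun x => x + h))//.
- by congr fine; apply: eq_integral => x _; rewrite dF/= mulr1.
- by move=> x y _ _; rewrite ltrD2r.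
- by rewrite dF => x _; exact: cvg_cst.
- by rewrite dF; exact: is_cvg_cst.
- by rewrite dF; exact: is_cvg_cst.
- split; first by move=> x _.
  + exact/cvg_at_right_filter/cF.
  + exact/cvg_at_left_filter/cF.
- exact: continuous_subspaceT.
Qed.

Lemma integrable_segment {R : realType} (g : R -> R) (a b : R) : continuous g ->
  lebesgue_measure.-integrable `[a, b]%classic (EFin \o g).
Proof.
move=> cg; apply: continuous_compact_integrable; first exact: segment_compact.
exact: continuous_subspaceT.
Qed.

(** The shift trades the piece over [[0, h]] for the one over [[T, T + h]], which has the same
    integral by periodicity. *)
Lemma Rintegral_periodic {R : realType} (g : R -> R) (T h : R) :
  continuous g -> (forall x, g (x + T) = g x) -> 0 <= h -> h <= T ->
  \int[lebesgue_measure]_(x in `[0, T]) g (x + h) =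
  \int[lebesgue_measure]_(x in `[0, T]) g x.
Proof.
move=> cg gT h0 hT; have T0 : 0 <= T by exact: le_trans hT.
rewrite Rintegral_shift// add0r.
have E (a b c : R) : a <= b -> b <= c ->
  \int[lebesgue_measure]_(x in `[a, c]) g x -
  \int[lebesgue_measure]_(x in `[a, b]) g x =
  \int[lebesgue_measure]_(x in `[b, c]) g x.
  move=> ab bc; rewrite Rintegral_itvB ?bnd_simp//; last exact: integrable_segment.
  rewrite Rintegral_itv_obnd_cbnd//.
  refine (integrableS _ _ _ (integrable_segment g b c cg)) => //.
  exact: subset_itv_oc_cc.
apply/eqP; rewrite -subr_eq0; apply/eqP.
have /eqP := E _ _ _ h0 hT; rewrite subr_eq => /eqP ->.
have := E h T (T + h) hT; rewrite lerDl h0 => /(_ isT) /eqP.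
rewrite subr_eq => /eqP ->.
rewrite -[X in `[X, T + h]]add0r [T + h]addrC -Rintegral_shift//.
under eq_Rintegral do rewrite gT; ring.
Qed.

(* [X + i Y] stands for a holomorphic function in polar coordinates: [t dX/dt]
   and [dY/dtheta] are both equal to [Z], and the integral of the latter over a
   period vanishes. *)
Lemma circle_mean_constant {R : realType} (X Y Z : R -> R -> R) (b T r : R) :
  0 < T ->
  (forall t u : R, 0 < t -> t < b -> is_derive t 1 (X^~ u) (Z t u / t)) ->
  (forall t : R, 0 < t -> t < b -> continuous (X t)) ->
  (forall t u : R, 0 < t -> t < b -> is_derive u 1 (Y t) (Z t u)) ->
  (forall t u : R, 0 < t -> t < b -> `|Z t u| <= r) ->
  (forall t u : R, Y t (u + T) = Y t u) ->
  forall s t : R, 0 < s -> s < t -> t < b ->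
  \int[lebesgue_measure]_(u in `[0, T]) X s u =
  \int[lebesgue_measure]_(u in `[0, T]) X t u.
Proof.
move=> T0 dX cX dY Zr YT.
pose I := `[0, T]%classic : set R.
have mI : measurable I by exact: measurable_itv.
have icst (c : R) : lebesgue_measure.-integrable I (EFin \o (fun=> c)).
  by apply: integrable_segment; exact: cst_continuous.
have T2 : 0 < T / 2 by rewrite divr_gt0.
have T2' : T / 2 < T by rewrite ltr_pdivrMr// mulr2n mulrDr mulr1 ltrDl.
(* [Z t] may be discontinuous in the angle. In place of the fundamental theorem of calculus, the
   integral of a shifted [Y t], constant by periodicity, is differentiated with respect to the
   shift. *)
have Z0 (t : R) : 0 < t -> t < b -> \int[lebesgue_measure]_(u in I) (Z t u / t) = 0.
  move=> t0 tb.
  have cY : continuous (Y t).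
    move=> u; apply/differentiable_continuous/derivable1_diffP.
    by have [] := dY t u t0 tb.
  (* The offset [- T / 2] makes the interior point [h = T / 2] of []0, T[] correspond to no shift;
     [Rintegral_periodic] handles shifts between [0] and [T]. *)
  pose f (h u : R) := Y t (u - T / 2 + h) / t.
  have cf h : continuous (f h).
    move=> u; apply: cvgMl.
    apply: (@continuous_comp _ _ _ (fun u => u - T / 2 + h) (Y t)); last exact: cY.
    by apply: cvgD; [apply: cvgB => //|]; exact: cvg_cst.
  have df (h u : R) : is_derive h 1 (f^~ u) (Z t (u - T / 2 + h) / t).
    suff D : is_derive h 1 (fun h : R => Y t (u - T / 2 + h)) (Z t (u - T / 2 + h)).
      have -> : f^~ u = t^-1 *: (fun h : R => Y t (u - T / 2 + h)).
        by apply/funext => k; rewrite /f mulrC.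
      rewrite [X in is_derive _ _ _ X]mulrC.
      exact: is_deriveZ.
    rewrite -[Z _ _]mulr1; apply: (is_derive1_comp (f := Y t)); first exact: dY.
    by rewrite -[X in is_derive _ _ _ X]add0r; exact: is_deriveD.
  have d1 (h u : R) : partial1of2 f h u = Z t (u - T / 2 + h) / t.
    by rewrite partial1of2E (@derive_val _ _ _ _ _ _ _ (df h u)).
  have rt0 : 0 <= r / t by rewrite divr_ge0 ?(ltW t0)//; apply: le_trans (Zr t 0 t0 tb).
  have Ia : `]0, T[%classic (T / 2) by rewrite /= in_itv /= T2 T2'.
  have := @differentiation_under_integral R _ _ lebesgue_measure f I mI
    (T / 2) 0 T Ia (fun x _ => integrable_segment _ 0 T (cf x))
    (fun x y _ _ => @ex_derive _ _ _ _ _ _ _ (df x y)) (fun=> r / t) (fun=> rt0) (icst _).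
  have H (x y : R) : `]0, T[%classic x -> I y -> `|partial1of2 f x y| <= r / t.
    move=> _ _; rewrite d1 normrM normfV (gtr0_norm t0) ler_wpM2r ?Zr//.
    by rewrite invr_ge0 ltW.
  move=> /(_ H) {H}.
  have -> : \int[lebesgue_measure]_(y in I) partial1of2 f (T / 2) y =
            \int[lebesgue_measure]_(y in I) (Z t y / t).
    by apply: eq_Rintegral => u _; rewrite d1 subrK.
  move=> <-.
  pose c := \int[lebesgue_measure]_(u in I) (Y t (u - T / 2) / t).
  rewrite derive1E; have [_] := is_derive_cst c (T / 2 : R) (1 : R).
  move=> <-; apply: near_eq_derive.
  have [e /= e0 He] := near_in_itvoo Ia.
  apply/nbhs_normP; exists e => //= x xe.
  have := He x xe; rewrite in_itv /= => /andP[x0 xT].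
  rewrite /c /f /=; under eq_Rintegral do rewrite addrAC.
  apply: (@Rintegral_periodic _ (fun u => Y t (u - T / 2) / t)); rewrite ?ltW//.
    move=> u; have := cf 0 u; rewrite /f; under eq_fun do rewrite addr0; exact.
  by move=> u; rewrite addrAC YT.
pose F (t : R) := \int[lebesgue_measure]_(u in I) X t u.
have dF (t : R) : 0 < t -> t < b -> is_derive t 1 F 0.
  move=> t0 tb.
  have Ia : `]t / 2, b[%classic t.
    by rewrite /= in_itv /= tb andbT ltr_pdivrMr// mulr2n mulrDr mulr1 ltrDl.
  have pos (x : R) : `]t / 2, b[%classic x -> 0 < x /\ x < b.
    rewrite /= in_itv /= => /andP[? ->]; split=> //.
    by apply: lt_trans (_ : t / 2 < x); rewrite // divr_gt0.
  have d1 (x u : R) : `]t / 2, b[%classic x -> partial1of2 X x u = Z x u / x.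
    move=> /pos[x0 xb].
    by rewrite partial1of2E (@derive_val _ _ _ _ _ _ _ (dX x u x0 xb)).
  have r0 : 0 <= r by apply: le_trans (Zr t 0 t0 tb).
  (* Staying above [t / 2] keeps [1 / x] bounded, so a constant dominates the radial derivative. *)
  have G0 : 0 <= r / (t / 2) by rewrite !divr_ge0// ltW.
  have H1 (x : R) : `]t / 2, b[%classic x -> lebesgue_measure.-integrable I (EFin \o X x).
    by move=> /pos[x0 xb]; apply: integrable_segment; exact: cX.
  have H2 (x y : R) : `]t / 2, b[%classic x -> I y -> derivable (X^~ y) x 1.
    by move=> /pos[x0 xb] _; have [] := dX x y x0 xb.
  have H3 (x y : R) : `]t / 2, b[%classic x -> I y -> `|partial1of2 X x y| <= r / (t / 2).
    move=> xI _; have [x0 xb] := pos _ xI; rewrite d1// normrM normfV (gtr0_norm x0).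
    rewrite ler_pM ?Zr ?invr_ge0 ?(ltW x0)// lef_pV2 ?posrE ?divr_gt0//.
    by move: xI; rewrite /= in_itv /= => /andP[/ltW].
  have D := @derivable_under_integral R _ _ lebesgue_measure X I mI
    t (t / 2) b Ia H1 H2 (fun=> r / (t / 2)) (fun=> G0) (icst _) H3.
  have E := @differentiation_under_integral R _ _ lebesgue_measure X I mI
    t (t / 2) b Ia H1 H2 (fun=> r / (t / 2)) (fun=> G0) (icst _) H3.
  split; first exact: D.
  rewrite -derive1E [LHS]E.
  under eq_Rintegral do rewrite d1//.
  exact: Z0.
move=> s t s0 st tb.
have sub x : x \in `[s, t] -> 0 < x /\ x < b.
  by rewrite in_itv /= => /andP[/(lt_le_trans s0) -> /le_lt_trans ->].
have [||x _] := @MVT R F (fun=> 0) s t st.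
- move=> x /subset_itv_oo_cc /sub[x0 xb]; exact: dF.
- apply: derivable_within_continuous => x /sub[x0 xb].
  by have [] := dF x x0 xb.
- by rewrite mul0r => /eqP; rewrite subr_eq0 => /eqP /esym.
Qed.

(** * The complex exponential and logarithm, and numerical bounds on pi and e *)

Section Exponential_and_logarithm.
Context {R : realType}.
Implicit Types (x z u : R[i]).

Lemma expC0 : expC 0 = 1 :> R[i].
Proof. by rewrite /expC /= expR0 cos0 sin0 mul1r. Qed.

Lemma expCD (x y : R[i]) : expC (x + y) = expC x * expC y.
Proof.
case: x y => [a b] [c d]; rewrite /expC /= expRD cosD sinD rmorphM /=.
apply/eqP; rewrite eq_complex /=; apply/andP; split; apply/eqP; ring.
Qed.

Lemma expC_neq0 x : expC x != 0.
Proof.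
apply/eqP => E; have := expC0; rewrite -(subrr x) expCD E mul0r => /esym/eqP.
by rewrite oner_eq0.
Qed.

Lemma is_derive0_bound (f : R -> R) (l e : R) : is_derive (0 : R) 1 f l -> 0 < e ->
  exists2 d, 0 < d & forall h, `|h| < d -> `|f h - f 0 - l * h| <= e * `|h|.
Proof.
move=> /is_derive1P H /H /nbhs_normP[d /= d0 Hd]; exists d => // h hd.
by have := Hd h; rewrite /= sub0r normrN addr0; exact.
Qed.

Lemma is_derive_expC0 : is_derive (0 : R[i]^o) 1 (@expC R) 1.
Proof.
apply/is_derive_normcP => e e0.
(* The real and imaginary parts of the remainder will each be at most [3 * (k * n)], hence [e / 8];
   [k <= 1] and [n < k / 2] ensure [|E - 1| <= k] and [|E| <= 2]. *)
pose k := Num.min (e / 8) 1.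
have k0 : 0 < k by rewrite lt_min ltr01 divr_gt0.
have k1 : k <= 1 by rewrite /k ge_min lexx orbT.
have ke : k <= e / 8 by rewrite /k ge_min lexx.
have D1 := is_derive_expR (0 : R); rewrite expR0 in D1.
have D2 := is_derive_cos (0 : R); rewrite sin0 oppr0 in D2.
have D3 := is_derive_sin (0 : R); rewrite cos0 in D3.
have [d1 d10 H1] := is_derive0_bound expR 1 k D1 k0.
have [d2 d20 H2] := is_derive0_bound cos 0 k D2 k0.
have [d3 d30 H3] := is_derive0_bound sin 1 k D3 k0.
exists (Num.min (Num.min d1 (k / 2)) (Num.min d2 d3)).
  by rewrite !lt_min d10 d20 d30 divr_gt0.
case=> a b; rewrite !lt_min => /andP[/andP[h1 hk] /andP[h2 h3]].
set n := normc _ in h1 hk h2 h3 *.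
have na : `|a| <= n by exact: (normr_Re (a +i* b)).
have nb : `|b| <= n by exact: (normr_Im (a +i* b)).
have n0 : 0 <= n by exact: normc_ge0.
have {}H1 := H1 a (le_lt_trans na h1).
have {}H2 := H2 b (le_lt_trans nb h2).
have {}H3 := H3 b (le_lt_trans nb h3).
rewrite expR0 mul1r in H1; rewrite cos0 mul0r subr0 in H2; rewrite sin0 mul1r subr0 in H3.
rewrite expC0 addr0 mul1r /expC.
apply: le_trans (normc_le_ReIm _) _ => /=.
move: H1 H2 H3; move: (expR a) (cos b) (sin b) => E c s H1 H2 H3.
have kn : k * n <= e / 8 * n by exact: ler_wpM2r.
have Ha : k * `|a| <= k * n by rewrite ler_wpM2l// ltW.
have Hb : k * `|b| <= k * n by rewrite ler_wpM2l// ltW.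
have nk : k * n <= n by rewrite ler_piMl.
have E2 : `|E - 1| <= k.
  apply: le_trans (_ : 2 * n <= _); last by lra.
  have -> : E - 1 = (E - 1 - a) + a by rewrite subrK.
  apply: le_trans (ler_normD _ _) _; lra.
have E3 : `|E| <= 2.
  have -> : E = (E - 1) + 1 by rewrite subrK.
  apply: le_trans (ler_normD _ _) _; rewrite normr1; lra.
have e1 : `|E * c - 0 * s - 1 - a| <= 3 * (k * n).
  have -> : E * c - 0 * s - 1 - a = (E - 1 - a) + E * (c - 1) by ring.
  apply: le_trans (ler_normD _ _) _; rewrite normrM.
  have : `|E| * `|c - 1| <= 2 * (k * n) by apply: ler_pM => //; exact: le_trans Hb.
  lra.
have e2 : `|E * s + 0 * c - 0 - b| <= 3 * (k * n).
  have -> : E * s + 0 * c - 0 - b = (E - 1) * b + E * (s - b) by ring.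
  apply: le_trans (ler_normD _ _) _; rewrite !normrM.
  have : `|E| * `|s - b| <= 2 * (k * n) by apply: ler_pM => //; exact: le_trans Hb.
  have : `|E - 1| * `|b| <= k * n by apply: ler_pM.
  lra.
have : 6 * (k * n) <= e * n by nra.
lra.
Qed.

Lemma is_derive_expC x : is_derive (x : R[i]^o) 1 (@expC R) (expC x).
Proof.
apply/is_derive_normcP => e e0.
have c0 : 0 < normc (expC x).
  by rewrite lt_neqAle normc_ge0 andbT eq_sym; apply: contra (expC_neq0 x) => /eqP/eq0_normc/eqP.
have /is_derive_normcP H := is_derive_expC0.
have /H[d d0 Hd] : 0 < e / normc (expC x) by rewrite divr_gt0.
exists d => // h /Hd; rewrite addr0 expC0 mul1r expCD => B.
have -> : expC h * expC x - expC x - expC x * h = expC x * (expC h - 1 - h) by ring.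
rewrite normcM; apply: le_trans (ler_wpM2l (ltW c0) B) _.
by rewrite mulrA mulrCA mulfV ?mulr1 ?gt_eqF.
Qed.

(** The principal branch on the right half-plane: the arctangent is the argument of [u] when
    [Re u > 0]. *)
Definition logC (u : R[i]^o) : R[i]^o :=
  ln (normc u) +i* atan (complex.Im u / complex.Re u).

Lemma logC1 : logC 1 = 0.
Proof. by rewrite /logC normc1 ln1 /= mul0r atan0. Qed.

Lemma normc_gt0 u : 0 < complex.Re u -> 0 < normc u.
Proof. by move=> u0; apply: lt_le_trans u0 _; apply: le_trans (normr_Re _); exact: ler_norm. Qed.

Lemma logCK u : 0 < complex.Re u -> expC (logC u) = u.
Proof.
case: u => a b /= a0; rewrite /expC /logC.
have n0 := @normc_gt0 (a +i* b) a0.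
rewrite lnK ?posrE//.
have C : cos (atan (b / a)) = a / normc (a +i* b).
  rewrite cos_atan.
  have -> : 1 + (b / a) ^+ 2 = (a ^+ 2 + b ^+ 2) / a ^+ 2.
    by field; rewrite gt_eqF.
  by rewrite sqrtrM ?addr_ge0 ?sqr_ge0// sqrtrV ?sqr_ge0// sqrtr_sqr gtr0_norm// invf_div.
have c0 : cos (atan (b / a)) != 0 by rewrite C gt_eqF ?divr_gt0.
have S : sin (atan (b / a)) = b / normc (a +i* b).
  rewrite -[LHS](divfK c0) -/(tan _) atanK C.
  by field; rewrite !gt_eqF.
rewrite C S -/(normc (a +i* b)).
move: n0; move: (normc _) => n n0.
apply/eqP; rewrite eq_complex /=; apply/andP; split; apply/eqP; field; rewrite gt_eqF//.
Qed.

Lemma normcB_le (x y : R[i]) : normc x - normc y <= normc (x - y).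
Proof. by rewrite lerBlDr; apply: le_trans (le_normcD _ _); rewrite subrK. Qed.

Lemma logC_continuous u (e : R) : 0 < complex.Re u -> 0 < e ->
  exists2 d : R, 0 < d & forall h, normc h < d -> normc (logC (h + u) - logC u) < e.
Proof.
move=> u0 e0; have n0 := normc_gt0 u u0.
have e2 : 0 < e / 2 by rewrite divr_gt0.
have /cvgrPdist_lt/(_ _ e2)/nbhs_normP[d1 d10 H1] := continuous_ln n0.
have /cvgrPdist_lt/(_ _ e2)/nbhs_normP[d2 d20 H2] :=
  @continuous_atan R (complex.Im u / complex.Re u).
have a0 := u0; set a := complex.Re u in a0 H2 *; set b := complex.Im u in H2 *.
rewrite /= in d10 d20 H1 H2.
(* [M] is a Lipschitz constant for the quotient [Im / Re] near [u]: its increment is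
   [(b * x - a * y) / (a * (x + a))], and [x + a > a / 2]. *)
pose M := 2 * (a + `|b|) / a ^+ 2.
have M0 : 0 < M by rewrite divr_gt0 ?mulr_gt0 ?exprn_gt0// ltr_pwDl.
exists (Num.min d1 (Num.min (a / 2) (d2 / M))); first by rewrite !lt_min d10 (divr_gt0 a0)//= (divr_gt0 d20 M0).
move=> h; rewrite !lt_min => /andP[h1 /andP[h2 h3]].
apply: le_lt_trans (normc_le_ReIm _) _ => /=.
rewrite [ltRHS](splitr e) ltrD//.
  rewrite distrC; apply: H1; rewrite /= distrC.
  apply: le_lt_trans h1; rewrite ler_norml; apply/andP; split.
    rewrite lerNl opprB; apply: le_trans (normcB_le _ _) _.
    by rewrite opprD addrCA subrr addr0 normcN.
  by apply: le_trans (normcB_le _ _) _; rewrite addrK.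
rewrite distrC; apply: H2.
rewrite /= !raddfD /= -/a -/b.
move: (normr_Re h) (normr_Im h) h2 h3; move: (complex.Re h) (complex.Im h) => x y.
move: (normc h) => n nx ny h2 h3.
have xa : a / 2 < x + a by move: nx; rewrite ler_norml => /andP[]; lra.
have xa0 : 0 < x + a by apply: lt_trans xa; rewrite divr_gt0.
have -> : b / a - (y + b) / (x + a) = (b * x - a * y) / (a * (x + a)).
  by field; rewrite !gt_eqF.
rewrite normrM normfV [X in _ / X]gtr0_norm ?mulr_gt0//.
have hM : n * M < d2 by rewrite -ltr_pdivlMr.
apply: le_lt_trans hM; rewrite ler_pdivrMr ?mulr_gt0//.
have B : `|b * x - a * y| <= (a + `|b|) * n.
  apply: le_trans (ler_normB _ _) _; rewrite !normrM (gtr0_norm a0).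
  have := ler_wpM2l (normr_ge0 b) nx; have := ler_wpM2l (ltW a0) ny; lra.
apply: le_trans B _.
have n0' : 0 <= n by apply: le_trans nx.
have -> : n * M * (a * (x + a)) = (a + `|b|) * n * (2 * (x + a) / a).
  by rewrite /M; field; rewrite gt_eqF.
rewrite ler_peMr ?mulr_ge0 ?addr_ge0 ?(ltW a0)//.
rewrite ler_pdivlMr// mul1r; lra.
Qed.

(** Inverse function argument: with [k] the increment of [logC], differentiating [expC] at [logC u]
    gives [h = u * k + o(k)], and continuity of [logC] makes [k] small. *)
Lemma is_derive_logC u : 0 < complex.Re u -> is_derive (u : R[i]^o) 1 logC u^-1.
Proof.
move=> u0; have n0 := normc_gt0 u u0.
have un0 : u != 0 by apply: contraTneq n0 => ->; rewrite normc0 ltxx.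
apply/is_derive_normcP => e e0.
(* The first bound absorbs the error into [normc k * normc u <= 2 * normc h]; the second then turns
   [eta * normc k] into the required multiple of [normc h]. *)
pose eta := Num.min (normc u / 2) (e * normc u ^+ 2 / 2).
have eta0 : 0 < eta by rewrite lt_min !divr_gt0 ?mulr_gt0 ?exprn_gt0.
have eta1 : eta <= normc u / 2 by rewrite /eta ge_min lexx.
have eta2 : eta <= e * normc u ^+ 2 / 2 by rewrite /eta ge_min lexx orbT.
have /is_derive_normcP/(_ _ eta0)[d d0 Hd] := is_derive_expC (logC u).
have [d' d'0 Hd'] := logC_continuous u d u0 d0.
exists (Num.min d' (complex.Re u)); first by rewrite lt_min d'0.
move=> h; rewrite lt_min => /andP[/Hd' k0 hu].
have hu0 : 0 < complex.Re (h + u).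
  rewrite raddfD /=; have := le_lt_trans (normr_Re h) hu.
  by rewrite ltr_norml => /andP[]; lra.
have := Hd _ k0; rewrite subrK !logCK// addrK.
set k := logC (h + u) - logC u => B.
have E : k - u^-1 * h = - u^-1 * (h - u * k) by field.
have nE : normc (k - u^-1 * h) * normc u <= eta * normc k.
  apply: le_trans B; rewrite E normcM normcN normcV mulrAC mulVf ?mul1r//.
  by rewrite gt_eqF.
have kb : normc k * normc u <= 2 * normc h.
  have : normc (u * k) <= normc h + normc (h - u * k).
    by rewrite -lerBlDl -[normc (h - _)]normcN opprB; exact: normcB_le.
  rewrite normcM => L.
  have : eta * normc k <= normc u / 2 * normc k by rewrite ler_wpM2r ?normc_ge0.
  lra.
have : normc (k - u^-1 * h) * normc u <= e * normc h * normc u.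
  apply: le_trans nE _.
  apply: le_trans (_ : e * normc u ^+ 2 / 2 * normc k <= _).
    by rewrite ler_wpM2r ?normc_ge0.
  have -> : e * normc u ^+ 2 / 2 * normc k = e / 2 * normc u * (normc k * normc u) by field.
  have -> : e * normc h * normc u = e / 2 * normc u * (2 * normc h) by field.
  by rewrite ler_wpM2l// mulr_ge0 ?(ltW n0)// ltW// divr_gt0.
by rewrite ler_pM2r.
Qed.

(** For [c = conjc x / normc x] the product [c * x] is [normc x]. Bounds on moduli thus reduce to
    one-sided bounds on real functions. *)
Lemma normc_le_Re x (B : R) :
  (forall c, normc c = 1 -> complex.Re (c * x) <= B) -> normc x <= B.
Proof.
move=> H; have [x0|x0] := eqVneq x 0.
  by have := H 1 (normc1 _); rewrite x0 mulr0 normc0.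
have n0 : 0 < normc x.
  by rewrite lt_neqAle normc_ge0 andbT eq_sym; apply: contra x0 => /eqP/eq0_normc/eqP.
have := H (conjc x / (normc x)%:C); rewrite normcM normcV normc_real gtr0_norm//.
have -> : normc (conjc x) = normc x by case: (x) => a b /=; rewrite sqrrN.
rewrite mulfV ?gt_eqF// => /(_ erefl).
suff -> : complex.Re (conjc x / (normc x)%:C * x) = normc x by [].
have -> : conjc x / (normc x)%:C * x = (conjc x * x) / (normc x)%:C by rewrite mulrAC.
have -> : conjc x * x = (normc x)%:C * (normc x)%:C.
  case: (x) => a b; rewrite -rmorphM /= -expr2 sqr_sqrtr ?addr_ge0 ?sqr_ge0//.
  by apply/eqP; rewrite eq_complex /=; apply/andP; split; apply/eqP; ring.
by rewrite mulfK//; apply/eqP => /complexI /eqP; rewrite gt_eqF.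
Qed.

Lemma Re_mul_le c x : normc c = 1 -> complex.Re (c * x) <= normc x.
Proof.
move=> c1; apply: le_trans (ler_norm _) _; apply: le_trans (normr_Re _) _.
by rewrite normcM c1 mul1r.
Qed.

(** Along [1 + t x] the derivative of the logarithm is bounded by [normc x / (1 - t * normc x)], the
    derivative of [- ln (1 - t * normc x)]. *)
Lemma normc_logC_le x : normc x < 1 -> normc (logC (1 + x)) <= - ln (1 - normc x).
Proof.
move=> x1; apply: normc_le_Re => c c1.
have n0 := normc_ge0 x.
have pos (t : R) : 0 <= t -> t <= 1 -> 0 < 1 - t * normc x.
  by move=> t0 t1; rewrite subr_gt0; apply: le_lt_trans x1; rewrite ler_piMl.
have Ret (t : R) : 0 <= t -> t <= 1 -> 1 - t * normc x <= complex.Re (1 + t%:C * x).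
  move=> t0 t1; rewrite raddfD /= lerD2l lerNl -raddfN /=.
  apply: le_trans (ler_norm _) _; apply: le_trans (normr_Re _) _.
  by rewrite normcN normcM normc_real ger0_norm.
pose G t := complex.Re (c * logC (1 + t%:C * x)) + ln (1 - t * normc x).
pose dG t := complex.Re (c * ((1 + t%:C * x)^-1 * x)) - normc x / (1 - t * normc x).
have dGP (t : R) : 0 <= t -> t <= 1 -> is_derive t 1 G (dG t).
  move=> t0 t1; apply: is_deriveD.
    apply: (@is_derive_Re _ (fun z => logC (1 + z * x))).
    apply: (is_derive_comp logC (fun z : R[i]^o => 1 + z * x)).
      by apply: is_derive_logC; apply: lt_le_trans (Ret t t0 t1); exact: pos.
    exact: is_derive_affine.
  have -> : - (normc x / (1 - t * normc x)) = (1 - t * normc x)^-1 * (- normc x).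
    by rewrite mulrN mulrC.
  apply: (is_derive1_comp (f := @ln R) (g := fun s : R => 1 - s * normc x)).
    by apply: is_derive1_ln; exact: pos.
  have -> : (fun s : R => 1 - s * normc x) = (fun s => 1 + s * - normc x).
    by apply/funext => z; rewrite mulrN.
  exact: (@is_derive_affine R).
have dG0 (t : R) : 0 <= t -> t <= 1 -> dG t <= 0.
  move=> t0 t1; rewrite /dG subr_le0; apply: le_trans (Re_mul_le c _ c1) _.
  rewrite normcM normcV mulrC ler_wpM2l// lef_pV2 ?posrE ?pos//.
    by apply: le_trans (Ret t t0 t1) _; apply: le_trans (normr_Re _); exact: ler_norm.
  apply: lt_le_trans (pos t t0 t1) _.
  by apply: le_trans (Ret t t0 t1) _; apply: le_trans (normr_Re _); exact: ler_norm.
have [||t +] := @MVT R G dG 0 1 ltr01.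
- by move=> t; rewrite in_itv /= => /andP[/ltW t0 /ltW t1]; exact: dGP.
- apply: derivable_within_continuous => t; rewrite in_itv /= => /andP[t0 t1].
  by have [] := dGP t t0 t1.
rewrite in_itv /= => /andP[/ltW t0 /ltW t1].
rewrite subr0 mulr1 /G !mul0r !mul1r addr0 logC1 mulr0 subr0 ln1 addr0 subr0.
by move=> E; have := dG0 t t0 t1; rewrite -E -lerBrDr sub0r.
Qed.

(** Euler's formula [pi / 4 = atan (1 / 2) + atan (1 / 3)], combined with [atan x <= x], gives
    [pi / 4 <= 5 / 6]. *)
Lemma pi_le : pi <= 10 / 3 :> R.
Proof.
have atan_le (x : R) : 0 < x -> atan x <= x.
  move=> x0; have [|t _] := @MVT R atan (fun t => (1 + t ^+ 2)^-1) 0 x x0.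
  - by apply: derivable_within_continuous => t _; exact: derivable_atan.
  rewrite atan0 !subr0 => ->; rewrite ler_piMl ?(ltW x0)// invf_le1 ?ltr_wpDr ?sqr_ge0//.
  by rewrite lerDl sqr_ge0.
have cn (x : R) : cos (atan x) != 0.
  by rewrite gt_eqF// cos_gt0_pihalf// atan_gtNpi2 atan_ltpi2.
have h2 : 0 < 2^-1 :> R by rewrite invr_gt0.
have h3 : 0 < 3^-1 :> R by rewrite invr_gt0.
have A2 := atan_le _ h2; have A3 := atan_le _ h3.
have B2 := lt_atan h2; have B3 := lt_atan h3; rewrite atan0 in B2 B3.
have p1 := @pihalf_ge1 R.
have E : atan (2^-1) + atan (3^-1) = pi / 4 :> R.
  apply: tan_inj.
  - by rewrite in_itv /=; apply/andP; split; lra.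
  - by rewrite in_itv /=; apply/andP; split; lra.
  by rewrite tanD// !atanK tan_piquarter; field.
lra.
Qed.

(** Together with [pi_le] this yields [1 + pi / 2 <= 8 / 3 < expR 1]. The 32nd power of
    [1 + 1 / 32 <= expR (1 / 32)] is precise enough. *)
Lemma expR1_gt : 267 / 100 < expR 1 :> R.
Proof.
have : (1 + 32^-1) ^+ 32 <= expR 1 :> R.
  have -> : expR 1 = expR (32^-1) ^+ 32 :> R by rewrite -expRM_natl mulfV.
  rewrite lerXn2r// ?nnegrE ?expR_ge0//; exact: expR_ge1Dx.
apply: lt_le_trans.
have -> : (1 + 32^-1) = 33 / 32 :> R by field.
by rewrite expr_div_n ltr_pdivlMr ?exprn_gt0//; lra.
Qed.

End Exponential_and_logarithm.

(** * Analytic functions along lines *)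

Lemma disc_line {R : realType} (z : R[i]) (t : R) : normc z < 1 -> 0 <= t -> t <= 1 ->
  normc (t%:C * z) < 1.
Proof.
move=> z1 t0 t1; rewrite normcM normc_real ger0_norm//.
by apply: le_lt_trans z1; rewrite ler_piMl ?normc_ge0.
Qed.

Lemma is_derive_analytic {R : realType} (p : R[i]^o -> R[i]^o) (z : R[i]^o) :
  analytic_in_disc p -> normc z < 1 -> is_derive z 1 p (p^`()%classic z).
Proof.
by move=> ap z1; rewrite derive1E; apply/derivableP/ap; rewrite normc_lt1.
Qed.

Lemma derive_line {R : realType} (f : R[i]^o -> R[i]^o) (x z l c : R[i]) (t : R) :
  is_derive (x + t%:C * z : R[i]^o) 1 f l ->
  is_derive t 1 (fun s : R => complex.Re (c * f (x + s%:C * z))) (complex.Re (c * (l * z))).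
Proof.
move=> df; apply: (@is_derive_Re _ (fun w => f (x + w * z))).
exact: (is_derive_comp f (fun w : R[i]^o => x + w * z) _ _ _ df (is_derive_affine x z t%:C)).
Qed.

(** * The bound on [z p'] *)

Section Subordinate_to_exponential.
Context {R : realType} (p : R[i]^o -> R[i]^o) (a1 a2 r : R).
Hypotheses (ap : analytic_in_disc p) (a10 : 0 < a1) (a20 : 0 < a2) (a21 : a2 < a1)
  (r0 : 0 <= r).
Hypothesis F_le : forall z : R[i]^o, normc z < 1 ->
  normc (a1%:C * z * p^`()%classic z + a2%:C * z ^+ 2 * p^`()^`()%classic z) <= (a1 - a2) * r.

(** On the segment from [0] to [z], the real parts [f] of [c p] and [v] of [c z p'] satisfy
    [t f' = v], the situation of [ray_bound]. *)
Lemma normc_zderive_le (z : R[i]) : normc z < 1 -> normc (z * p^`()%classic z) <= r.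
Proof.
move=> z1; apply: normc_le_Re => c c1.
pose v (t : R) := complex.Re (c * (t%:C * z * p^`()%classic (t%:C * z))).
pose f (t : R) := complex.Re (c * p (0 + t%:C * z)).
suff : v 1 <= r by rewrite /v mul1r.
have df (t : R) : 0 <= t -> t <= 1 ->
    is_derive t 1 f (complex.Re (c * (p^`()%classic (0 + t%:C * z) * z))).
  move=> t0 t1; apply: derive_line; apply: is_derive_analytic => //.
  by rewrite add0r; exact: disc_line.
have a12 : 0 < a1 - a2 by rewrite subr_gt0.
apply: (@ray_bound R f) => //.
- move=> t t0 t1; have := df t (ltW t0) t1; rewrite add0r.
  suff -> : v t / t = complex.Re (c * (p^`()%classic (t%:C * z) * z)) by [].
  rewrite /v -!mulrA.
  have E x : complex.Re (c * (t%:C * x)) = t * complex.Re (c * x).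
    by case: (c) x => [? ?] [? ?] /=; ring.
  by rewrite E mulrAC mulfV ?gt_eqF// mul1r [z * _]mulrC.
- apply/differentiable_continuous/derivable1_diffP.
  by have [] := df 0 (lexx _) ler01.
move=> t t0 t1 rv.
have tz1 := disc_line z t z1 (ltW t0) t1.
set w := t%:C * z in tz1 rv.
have Fw := F_le w tz1.
have vw : v t <= normc (w * p^`()%classic w) by exact: Re_mul_le.
(* Where [p'] is not derivable, the library value of its derivative is [0], so
   the bound on [F] reads [a1 |w p'(w)| <= (a1 - a2) r]. *)
have d2 : derivable (p^`()%classic : R[i]^o -> R[i]^o) w 1.
  apply: contrapT => nd.
  have p20 : p^`()^`()%classic w = 0.
    rewrite derive1E; exact: (dvgP nd).
  move: Fw; rewrite p20 mulr0 addr0 -mulrA normcM normc_real gtr0_norm// => Fw.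
  have : a1 * r < a1 * normc (w * p^`()%classic w).
    by rewrite ltr_pM2l//; exact: lt_le_trans vw.
  have : 0 <= a2 * r by rewrite mulr_ge0 ?(ltW a20).
  move: Fw; rewrite mulrBl; lra.
pose q' := p^`()%classic w + w * p^`()^`()%classic w.
exists (complex.Re (c * (q' * z))).
  have -> : v = (fun s : R => complex.Re (c * (fun x => x * p^`()%classic x) (0 + s%:C * z))).
    by apply/funext => s; rewrite add0r.
  apply: (derive_line (fun x => x * p^`()%classic x)); rewrite add0r -/w.
  have D : is_derive (w : R[i]^o) 1 (p^`()%classic : R[i]^o -> R[i]^o) (p^`()^`()%classic w).
    by rewrite derive1E; exact/derivableP.
  have -> : q' = w *: p^`()^`()%classic w + p^`()%classic w *: (1 : R[i]^o).
    by rewrite /q' addrC -[_ *: 1]/(_ * 1) mulr1.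
  exact: (@is_deriveM _ _ (@id (R[i]^o)) _ w 1 _ _ (is_derive_id _ _) D).
have -> : complex.Re (c * (q' * z)) = complex.Re (c * (w * q')) / t.
  have E x : complex.Re (c * (w * x)) = t * complex.Re (c * (x * z)).
    by rewrite /w; case: (c) (z) x => [? ?] [? ?] [? ?] /=; ring.
  by rewrite E mulrAC mulfV ?gt_eqF// mul1r.
(* Since [a2 w q' = F - (a1 - a2) w p'], the sign of [v'] is that of [Re (c F) - (a1 - a2) v], which
   cannot be positive once [v > r]. *)
rewrite pmulr_lle0 ?invr_gt0// -(pmulr_rle0 _ a20).
have -> : a2 * complex.Re (c * (w * q')) =
    complex.Re (c * (a1%:C * w * p^`()%classic w + a2%:C * w ^+ 2 * p^`()^`()%classic w))
    - (a1 - a2) * v t.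
  rewrite /v -/w /q' expr2; move: (p^`()%classic w) (p^`()^`()%classic w) => x y.
  by case: (c) (w) x y => [? ?] [? ?] [? ?] [? ?] /=; ring.
rewrite subr_le0; apply: le_trans (Re_mul_le c _ c1) _; apply: le_trans Fw _.
by rewrite ler_wpM2l ?ltW.
Qed.


(** * Polar coordinates and the mean value estimate *)

Definition cis (t : R) : R[i] := cos t +i* sin t.

Lemma expC_i t : expC (t%:C * 'i) = cis t.
Proof.
have -> : t%:C * 'i = 0 +i* t.
  by apply/eqP; rewrite eq_complex /=; apply/andP; split; apply/eqP; ring.
by rewrite /expC expR0 mul1r.
Qed.

Lemma normc_cis t : normc (cis t) = 1.
Proof. by rewrite /cis /= cos2Dsin2 sqrtr1. Qed.

Lemma cisDpi t : cis (t + pi) = - cis t.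
Proof. by rewrite /cis cosDpi sinDpi. Qed.

Lemma derive_radius (z c : R[i]) (t u : R) : 0 < t -> t * normc z < 1 ->
  is_derive t 1 (fun s : R => complex.Re (c * p (s%:C * (z * cis u))))
    (complex.Re (c * (t%:C * (z * cis u) * p^`()%classic (t%:C * (z * cis u)))) / t).
Proof.
move=> t0 tz; set y := z * cis u.
have y1 : normc (t%:C * y) < 1.
  by rewrite /y !normcM normc_real gtr0_norm// normc_cis mulr1.
have := @derive_line _ p 0 y (p^`()%classic (t%:C * y)) c t.
rewrite add0r => /(_ (is_derive_analytic _ _ ap y1)).
have -> : (fun s : R => complex.Re (c * p (0 + s%:C * y))) =
    (fun s : R => complex.Re (c * p (s%:C * y))).
  by apply/funext => s; rewrite add0r.
suff -> : complex.Re (c * (t%:C * y * p^`()%classic (t%:C * y))) / t =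
  complex.Re (c * (p^`()%classic (t%:C * y) * y)) by [].
have E x : complex.Re (c * (t%:C * y * x)) = t * complex.Re (c * (x * y)).
  by case: (c) (y) x => [? ?] [? ?] [? ?] /=; ring.
by rewrite E mulrAC mulfV ?gt_eqF// mul1r.
Qed.

(** With [derive_radius] this is the Cauchy-Riemann system in polar form: the two derivatives come
    from the same [z p'], here with a factor ['i]. *)
Lemma derive_angle (y c : R[i]) (u : R) : normc y < 1 ->
  is_derive u 1 (fun s : R => complex.Re (c * p (y * cis s)))
    (complex.Re (c * ('i * (y * cis u * p^`()%classic (y * cis u))))).
Proof.
move=> y1.
have y1' : normc (y * cis u) < 1 by rewrite normcM normc_cis mulr1.
have dp := is_derive_analytic _ _ ap y1'.
(* [cis] takes a real angle; [expC] extends it to a complex variable, so that the complex chain rule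
   applies before restriction to real [s]. *)
have de : is_derive (u%:C : R[i]^o) 1 (fun x : R[i]^o => expC (0 + x * 'i)) (cis u * 'i).
  rewrite -expC_i -[in X in is_derive _ _ _ X](add0r (u%:C * 'i)).
  exact: (is_derive_comp _ (fun w : R[i]^o => 0 + w * 'i) _ _ _ (is_derive_expC _) (is_derive_affine 0 'i u%:C)).
have dg : is_derive (u%:C : R[i]^o) 1 (fun x : R[i]^o => y * expC (0 + x * 'i) : R[i]^o) (y * (cis u * 'i)).
  exact: (is_deriveZ y de).
have E s : expC (0 + s%:C * 'i) = cis s by rewrite add0r expC_i.
have -> : (fun s : R => complex.Re (c * p (y * cis s))) =
    (fun s => complex.Re (c * p (y * expC (0 + s%:C * 'i)))).
  by apply/funext => s; rewrite E.
have -> : 'i * (y * cis u * p^`()%classic (y * cis u)) =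
  p^`()%classic (y * cis u) * (y * (cis u * 'i)) by ring.
apply: (@is_derive_Re _ (fun x => p (y * expC (0 + x * 'i)))).
rewrite -[cis u]E in dp dg *.
exact: (is_derive_comp p (fun x : R[i]^o => y * expC (0 + x * 'i) : R[i]^o) _ _ _ dp dg).
Qed.

Lemma continuous_derive (f : R -> R) : (forall t : R, derivable f t 1) -> continuous f.
Proof. by move=> df t; apply/differentiable_continuous/derivable1_diffP. Qed.


Hypothesis p0 : p 0 = 1.

(** For [u] in [[0, pi]], [X 1 u] falls short of twice [Re (c * p z)] by at most [r * pi], while the
    mean of [X 1] there is at most [2 * Re c]. *)
Lemma normc_sub1_le (z : R[i]) : normc z < 1 -> normc (p z - 1) <= r * pi / 2.
Proof.
move=> z1; apply: normc_le_Re => c c1.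
have q_le := normc_zderive_le.
pose P (d : R[i]) (t u : R) := complex.Re (d * p (t%:C * (z * cis u))).
(* Folding [u] and [u + pi] together makes the bound on [X 1 0 - X 1 u] below
   independent of [u]. *)
pose X t u := P c t u + P c t (u + pi).
(* The real part of [- 'i * c * x] is the imaginary part of [c * x], so [Y] is the harmonic
   conjugate of [X]. *)
pose Y t u := P (- 'i * c) t u + P (- 'i * c) t (u + pi).
pose Q (t u : R) := complex.Re (c * (t%:C * (z * cis u) * p^`()%classic (t%:C * (z * cis u)))).
pose Z t u := Q t u + Q t (u + pi).
(* Room beyond [t = 1] inside the disc, because [circle_mean_constant] works on the open range
   [t < b]. *)
have [b b1 bz] : exists2 b : R, 1 < b & b * normc z < 1.
  have n0 : 0 < 1 + normc z by rewrite ltr_wpDr ?normc_ge0.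
  exists (2 / (1 + normc z)); first by rewrite ltr_pdivlMr// mul1r; lra.
  by rewrite mulrAC ltr_pdivrMr// mul1r; lra.
have b0 : 0 < b by exact: lt_trans b1.
have tz t : 0 < t -> t < b -> t * normc z < 1.
  by move=> t0 tb; apply: le_lt_trans bz; rewrite ler_wpM2r ?normc_ge0 ?ltW.
have yb t : 0 < t -> t < b -> normc (t%:C * z) < 1.
  by move=> t0 tb; rewrite normcM normc_real gtr0_norm ?tz.
have ub t u : 0 < t -> t < b -> normc (t%:C * (z * cis u)) < 1.
  by move=> t0 tb; rewrite mulrA normcM normc_cis mulr1 yb.
have dr d (t u : R) : 0 < t -> t < b -> is_derive t 1 ((P d)^~ u)
    (complex.Re (d * (t%:C * (z * cis u) * p^`()%classic (t%:C * (z * cis u)))) / t).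
  by move=> t0 tb; apply: derive_radius; rewrite ?tz.
have da d (t u : R) : 0 < t -> t < b -> is_derive u 1 (P d t)
    (complex.Re (d * ('i * (t%:C * (z * cis u) * p^`()%classic (t%:C * (z * cis u)))))).
  move=> t0 tb; rewrite /P; under [X in is_derive _ _ X _]funext => s do rewrite mulrA.
  by rewrite mulrA; apply: derive_angle; exact: yb.
have dshift (f : R -> R) (l h u : R) : is_derive (u + h) 1 f l ->
    is_derive u 1 (fun s : R => f (s + h)) l.
  move=> df; rewrite -[l]mulr1; apply: (is_derive1_comp (f := f)) => //.
  have -> : (fun s : R => s + h) = (fun s => h + s * 1).
    by apply/funext => s; rewrite mulr1 addrC.
  exact: (@is_derive_affine R).
have Ei x : complex.Re (- 'i * c * ('i * x)) = complex.Re (c * x).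
  by case: (c) x => [? ?] [? ?] /=; ring.
have Q_le t u : 0 < t -> t < b -> `|Q t u| <= r.
  move=> t0 tb; apply: le_trans (normr_Re _) _; rewrite normcM c1 mul1r.
  exact/q_le/ub.
have cX t : 0 < t -> t < b -> continuous (X t).
  move=> t0 tb; apply: continuous_derive => u.
  by have [] := is_derive_add _ _ _ _ _ (da c t u t0 tb)
    (dshift _ _ _ _ (da c t (u + pi) t0 tb)).
have per d t u : P d t (u + pi + pi) = P d t u by rewrite /P !cisDpi opprK.
have dX (t u : R) : 0 < t -> t < b -> is_derive t 1 (X^~ u) (Z t u / t).
  move=> t0 tb; rewrite /Z mulrDl.
  exact: (is_derive_add _ _ _ _ _ (dr c t u t0 tb) (dr c t (u + pi) t0 tb)).
have dY (t u : R) : 0 < t -> t < b -> is_derive u 1 (Y t) (Z t u).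
  move=> t0 tb; rewrite /Z -[Q t u]Ei -[Q t (u + pi)]Ei.
  exact: (is_derive_add _ _ _ _ _ (da _ t u t0 tb) (dshift _ _ _ _ (da _ t (u + pi) t0 tb))).
have Z_le t u : 0 < t -> t < b -> `|Z t u| <= r + r.
  by move=> t0 tb; apply: le_trans (ler_normD _ _) _; rewrite lerD ?Q_le.
have Yper t u : Y t (u + pi) = Y t u by rewrite /Y per addrC.
have M := @circle_mean_constant R X Y Z b pi (r + r) (pi_gt0 R) dX cX dY Z_le Yper.
have lenpi : fine (lebesgue_measure `[0, pi]%classic) = pi :> R.
  by rewrite lebesgue_measure_itv /= lte_fin pi_gt0 /= subr0.
have Icst (k : R) : \int[lebesgue_measure]_(u in `[0, pi]) k = k * pi.
  by rewrite Rintegral_cst ?lenpi.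
have icst (k : R) : lebesgue_measure.-integrable `[0, pi]%classic (EFin \o (fun=> k)).
  by apply: integrable_segment; exact: cst_continuous.
(* [M] carries the integral from [t = 1] to a small radius [s], where continuity at [0] keeps [p]
   within [e] of [p 0 = 1]. *)
have small (e : R) : 0 < e -> \int[lebesgue_measure]_(u in `[0, pi]) X 1 u <= (2 * (complex.Re c + e)) * pi.
  move=> e0.
  have := is_derive_analytic p 0 ap; rewrite normc0 => /(_ ltr01) [dp _].
  have : {for (0 : R[i]^o), continuous p} by exact/differentiable_continuous/derivable1_diffP.
  have eC : 0 < e%:C by rewrite ltcR.
  move=> /cvgrPdist_lt/(_ _ eC)/nbhs_normP[d d0 Hd]; rewrite /= in d0 Hd.
  have dR : (complex.Re d)%:C = d by rewrite RRe_real// ger0_real// ltW.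
  have dR0 : 0 < complex.Re d by rewrite -ltcR dR.
  pose s := Num.min (1 / 2) (complex.Re d / 2).
  have s0 : 0 < s by rewrite lt_min !divr_gt0.
  have s1 : s < 1 by rewrite /s gt_min; apply/orP; left; lra.
  have sd : s < complex.Re d by rewrite /s gt_min; apply/orP; right; lra.
  have sb : s < b by exact: lt_trans b1.
  rewrite -(M s 1 s0 s1 b1) -Icst.
  apply: le_Rintegral => //; first by apply: integrable_segment; exact: cX.
  move=> u _.
  have P_le v : P c s v <= complex.Re c + e.
    have : normc (p (s%:C * (z * cis v)) - 1) < e.
      rewrite -ltcR -p0 -[X in X < _]/(`|_ : R[i]^o|) distrC; apply: Hd => /=.
      rewrite sub0r normrN -dR ltcR mulrA normcM normc_cis mulr1 normcM normc_real gtr0_norm//.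
      by apply: le_lt_trans sd; rewrite ler_piMr ?ltW.
    have := Re_mul_le c (p (s%:C * (z * cis v)) - 1) c1.
    rewrite mulrBr mulr1 raddfB /P /=; lra.
  by rewrite /X mulr_natl mulr2n lerD.
have cis0 : cis 0 = 1 by rewrite /cis cos0 sin0.
have X1 u : 0 <= u -> u <= pi -> 2 * P c 1 0 - r * pi <= X 1 u.
  pose dP (v : R) := complex.Re (c * ('i * (1%:C * (z * cis v) * p^`()%classic (1%:C * (z * cis v))))).
  have dP1 (v : R) : is_derive v 1 (P c 1) (dP v) by exact: (da c 1 v ltr01 b1).
  have lip v w : v < w -> `|P c 1 w - P c 1 v| <= r * (w - v).
    move=> vw.
    have cP : {within `[v, w], continuous (P c 1)}%classic.
      apply: continuous_subspaceT; apply: continuous_derive => x.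
      by have [] := dP1 x.
    have [x _ ->] := MVT vw (fun x _ => dP1 x) cP.
    rewrite normrM [`|w - v|]gtr0_norm ?subr_gt0// ler_wpM2r ?subr_ge0 ?(ltW vw)//.
    rewrite /dP; apply: le_trans (normr_Re _) _; rewrite normcM c1 mul1r normcM.
    have -> : normc ('i : R[i]) = 1 by rewrite /= expr0n /= add0r expr1n sqrtr1.
    by rewrite mul1r; exact/q_le/ub.
  have lip' v w : v <= w -> `|P c 1 w - P c 1 v| <= r * (w - v).
    rewrite le_eqVlt => /predU1P[->|]; last exact: lip.
    by rewrite !subrr normr0 mulr0.
  move=> u0 up; have := lip' _ _ u0.
  (* The point at angle [u + pi] is reached backwards from the angle [2 pi], the same point as [0];
     the two arcs, [u] and [pi - u], add up to [pi]. *)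
  have : u + pi <= 0 + pi + pi by rewrite add0r lerD2r.
  move=> /lip'; rewrite per !ler_norml /X => /andP[_ A] /andP[B _].
  lra.
have low : (2 * P c 1 0 - r * pi) * pi <= \int[lebesgue_measure]_(u in `[0, pi]) X 1 u.
  rewrite -[leLHS]Icst; apply: le_Rintegral => //.
    by apply: integrable_segment; exact: cX.
  by move=> u; rewrite /= in_itv /= => /andP[]; exact: X1.
have -> : complex.Re (c * (p z - 1)) = P c 1 0 - complex.Re c.
  by rewrite /P cis0 mulr1 mul1r mulrBr mulr1 raddfB.
apply/ler_addgt0Pr => e e0.
have := le_trans low (small e e0); rewrite ler_pM2r ?pi_gt0//; lra.
Qed.

End Subordinate_to_exponential.

(** * The Moebius map and the subordination *)

(** The difference equals [(C - D) w / (1 + D w)], whose denominator has modulus at least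
    [1 - |D|]. *)
Lemma normc_mobius_sub1_le {R : realType} (C D : R) (w : R[i]) :
  D < C -> `|D| < 1 -> normc w < 1 ->
  normc ((1 + C%:C * w) / (1 + D%:C * w) - 1) * (1 - `|D|) <= C - D.
Proof.
move=> DC D1 w1; have w0 := normc_ge0 w.
have Dw : normc (D%:C * w) <= `|D|.
  by rewrite normcM normc_real ler_piMr//; exact: ltW.
have den : 1 - `|D| <= normc (1 + D%:C * w).
  have := normcB_le 1 (- (D%:C * w)); rewrite opprK normcN normc1; lra.
have den0 : 0 < normc (1 + D%:C * w) by apply: lt_le_trans den; rewrite subr_gt0.
have d0 : 1 + D%:C * w != 0 by apply: contraTneq den0 => ->; rewrite normc0 ltxx.
have -> : (1 + C%:C * w) / (1 + D%:C * w) - 1 = (C - D)%:C * w / (1 + D%:C * w).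
  by rewrite rmorphB; field.
rewrite !normcM normcV normc_real gtr0_norm ?subr_gt0//.
rewrite mulrAC ler_pdivrMr// -!mulrA; apply: ler_wpM2l; first by rewrite subr_ge0 ltW.
by apply: le_trans den; rewrite ler_piMl ?subr_ge0 ?(ltW D1) ?(ltW w1).
Qed.

Theorem theorem4p1 (R : realType) (C D a1 a2 : R) (p : R[i]^o -> R[i]^o) :
  -1 < D -> D < C -> C <= 1 -> 0 < a1 -> 0 < a2 ->
  (a1 - a2) * (1 - D ^+ 2) >= expR 1 * (C - D) * (1 + `|D|) ->
  analytic_in_disc p -> p 0 = 1 ->
  subordinate
    (fun z : R[i]^o => 1 + a1%:C * z * (derive1 p z) + a2%:C * z ^+ 2 * (derive1 (derive1 p) z))
    (fun z : R[i]^o => (1 + C%:C * z) / (1 + D%:C * z)) ->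
  subordinate p (@expC R).
Proof.
move=> D1 DC C1 a10 a20 H ap p0 [w [_ _ w1 E]].
have Dn : `|D| < 1 by rewrite ltr_norml D1 (lt_le_trans DC).
have e0 : 0 < expR 1 :> R := expR_gt0 _.
have Dpos : 0 < 1 + `|D| by rewrite ltr_wpDr.
(* Cancelling [1 + |D|] from [1 - D ^+ 2 = (1 - |D|) (1 + |D|)] leaves the form that matches
   [normc_mobius_sub1_le]. *)
have {}H : expR 1 * (C - D) <= (a1 - a2) * (1 - `|D|).
  rewrite -(ler_pM2r Dpos); apply: le_trans H _.
  have -> : 1 - D ^+ 2 = (1 - `|D|) * (1 + `|D|).
    by rewrite -[D ^+ 2]real_normK ?num_real//; ring.
  by rewrite mulrA.
have a21 : a2 < a1.
  rewrite -subr_gt0; have : 0 < (a1 - a2) * (1 - `|D|).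
    by apply: lt_le_trans H; rewrite mulr_gt0 ?subr_gt0.
  by rewrite pmulr_lgt0 ?subr_gt0.
pose r := (expR 1)^-1 : R.
have r0 : 0 < r by rewrite invr_gt0.
have F_le (z : R[i]^o) : normc z < 1 -> normc (a1%:C * z * p^`()%classic z
    + a2%:C * z ^+ 2 * p^`()^`()%classic z) <= (a1 - a2) * r.
  move=> z1; have z1' : `|z| < 1 by rewrite normc_lt1.
  have -> : a1%:C * z * p^`()%classic z + a2%:C * z ^+ 2 * p^`()^`()%classic z
     = (1 + C%:C * w z) / (1 + D%:C * w z) - 1.
    by apply/eqP; rewrite eq_sym subr_eq -E// [eqbRHS]addrC addrA.
  have wz : normc (w z) < 1 by rewrite -normc_lt1; exact: w1.
  have D0 : 0 < 1 - `|D| by rewrite subr_gt0.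
  rewrite -(ler_pM2r D0); apply: le_trans (normc_mobius_sub1_le C D _ DC Dn wz) _.
  by rewrite /r mulrAC ler_pdivlMr// mulrC.
have p1 (z : R[i]^o) : `|z| < 1 -> normc (p z - 1) <= r * pi / 2.
  rewrite normc_lt1; exact: (normc_sub1_le p a1 a2 r ap a10 a20 a21 (ltW r0) F_le p0).
(* Multiplied by e, this reads [pi / 2 < e - 1]. *)
have small : r * pi / 2 < 1 - r.
  rewrite -(ltr_pM2l e0) mulrBr /r !mulrA mulfV ?gt_eqF// mulr1 mul1r.
  have := @pi_le R; have := @expR1_gt R; lra.
have Rep (z : R[i]^o) : `|z| < 1 -> 0 < complex.Re (p z).
  move=> /p1 pz; have := le_trans (normr_Re _) pz.
  by rewrite raddfB /= ler_norml => /andP[]; lra.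
exists (fun z => logC (p z)); split.
- move=> z z1; rewrite normc_lt1 in z1.
  have [] // := is_derive_comp logC p z _ _ (is_derive_logC _ _) (is_derive_analytic p z ap z1).
  by apply: Rep; rewrite normc_lt1.
- by rewrite p0 logC1.
- move=> z z1; rewrite normc_lt1; have x1 := p1 z z1.
  have -> : p z = 1 + (p z - 1) by rewrite addrC subrK.
  have x2 : normc (p z - 1) < 1 by lra.
  apply: le_lt_trans (normc_logC_le _ x2) _.
  (* [- ln (1 - y) < 1] amounts to [1 / e < 1 - y], which [small] provides for
     [y = normc (p z - 1)]. *)
  rewrite ltrNl -[X in X < _](@expRK R) expRN ltr_ln ?posrE ?invr_gt0 ?subr_gt0//.
  by rewrite -/r; lra.
- by move=> z z1; rewrite logCK ?Rep.
Qed.
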